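(* Let $X\sim\mathcal{G}_d(\nu)$ with $\nu$ a Thorin measure on $\mathbb{R}_+^d$ satisfying $\int_{\mathbb{R}_+^d}\|s\|\,\nu(\mathrm{d}s)<\infty$, and let $K(x,y)=k(x,y)\,I_d$ with $k$ a scalar reproducing kernel on $\mathbb{R}^d$. Let $E,E'\sim\mathrm{Exp}(1)$ be independent and independent of $X$. Then the Stein kernel $K_\nu(x,y)=\mathcal{T}_\nu^{(x)}\mathcal{T}_\nu^{(y)}K(x,y)$ writes, for every $x,y\in\mathbb{R}^d$, $$\begin{aligned}K_\nu(x,y)=\;&\langle x,y\rangle\,k(x,y)-\int_{\mathbb{R}_+^d}\langle x,s\rangle\,\mathbb{E}\bigl[k(x,y+sE)\bigr]\,\nu(\mathrm{d}s)-\int_{\mathbb{R}_+^d}\langle s',y\rangle\,\mathbb{E}\bigl[k(x+s'E',y)\bigr]\,\nu(\mathrm{d}s')\\&+\int_{\mathbb{R}_+^d}\int_{\mathbb{R}_+^d}\langle s',s\rangle\,\mathbb{E}\bigl[k(x+s'E',y+sE)\bigr]\,\nu(\mathrm{d}s)\,\nu(\mathrm{d}s').\end{aligned}$$ For a finite Gamma convolution $X\sim\mathcal{G}_{d,n}(\alpha,s)$ with $\nu=\sum_{j=1}^n\alpha_j\delta_{s_j}$, this formula simplifies to $$\begin{aligned}K_\nu(x,y)=\;&\langle x,y\rangle\,k(x,y)-\sum_{j=1}^n\alpha_j\langle x,s_j\rangle\,\mathbb{E}\bigl[k(x,y+s_jE)\bigr]-\sum_{j=1}^n\alpha_j\langle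 s_j,y\rangle\,\mathbb{E}\bigl[k(x+s_jE',y)\bigr]\\&+\sum_{j,j'=1}^n\alpha_j\alpha_{j'}\langle s_{j'},s_j\rangle\,\mathbb{E}\bigl[k(x+s_{j'}E',y+s_jE)\bigr].\end{aligned}$$
   Context: $d\ge 1$ is a fixed integer, $\mathbb{R}_+=[0,\infty)$, $\langle\cdot,\cdot\rangle$ and $\|\cdot\|$ are the Euclidean scalar product and norm, $I_d$ is the $d\times d$ identity matrix, and $e_1,\dots,e_d$ is the canonical basis of $\mathbb{R}^d$. A scalar reproducing kernel on $\mathbb{R}^d$ is a symmetric positive semi-definite function $k:\mathbb{R}^d\times\mathbb{R}^d\to\mathbb{R}$. A Thorin measure on $\mathbb{R}_+^d$ is a positive Radon measure $\nu$ on $\mathbb{R}_+^d$ with $\int_{\{\|s\|\le 1\}}\bigl|\log\|s\|\bigr|\,\nu(\mathrm{d}s)<\infty$ and $\int_{\{\|s\|>1\}}\|s\|^{-1}\,\nu(\mathrm{d}s)<\infty$. A random vector $X$ with values in $\mathbb{R}_+^d$ satisfies $X\sim\mathcal{G}_d(\nu)$ if its characteristic function satisfies $\log\varphi_X(t)=-\int_{\mathbb{R}_+^d}\log(1-\mathrm{i}\langle s,t\rangle)\,\nu(\mathrm{d}s)$ for all $t\in\mathbb{R}^d$. It is a finite Gamma convolution, $X\sim\mathcal{G}_{d,n}(\alpha,s)$, when $\nu=\sum_{j=1}^n\alpha_j\delta_{s_j}$ is a purely atomic Thorin measure with positive weights $\alpha_j$ and atoms $s_j\in\mathbb{R}_+^d$.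 The Stein operator $\mathcal{T}_\nu$ acts on vector fields $f:\mathbb{R}^d\to\mathbb{R}^d$ by $$(\mathcal{T}_\nu f)(x)=\langle x,f(x)\rangle-\int_{\mathbb{R}_+^d}\mathbb{E}\bigl[\langle s,f(x+sE)\rangle\bigr]\,\nu(\mathrm{d}s),\qquad E\sim\mathrm{Exp}(1).$$ In $K_\nu(x,y)=\mathcal{T}_\nu^{(x)}\mathcal{T}_\nu^{(y)}K(x,y)$, the superscript indicates the variable on which $\mathcal{T}_\nu$ acts: for fixed $x$, $\Phi(x,y):=\mathcal{T}_\nu^{(y)}K(x,y)\in\mathbb{R}^d$ is the vector whose $j$-th component is $\mathcal{T}_\nu$ applied to the vector field $y\mapsto k(x,y)\,e_j$ (the $j$-th column of $K$); then $K_\nu(x,y)$ is $\mathcal{T}_\nu$ applied to the vector field $x\mapsto\Phi(x,y)$.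
   Formalization: The formal statement additionally assumes that k is jointly Borel measurable and that the integrals defining the Stein kernel converge absolutely at the point (x,y); without this K_ν can be undefined (e.g. d=1, ν=δ_1, k(x,y)=exp(xy), x=1). *)

(* Defs.v *)
From HB Require Import structures.
From mathcomp Require Import all_boot all_order all_algebra.
From mathcomp Require Import complex.
From mathcomp Require Import all_classical all_reals all_analysis.

Set Implicit Arguments.
Unset Strict Implicit.
Unset Printing Implicit Defensive.

Import Order.TTheory GRing.Theory Num.Theory.
Import numFieldNormedType.Exports.

Local Open Scope classical_set_scope.
Local Open Scope ring_scope.
Local Open Scope complex_scope.

(* Matrices, hence the vectors 'cV[R]_d of R^d, carry their Borel sigma-algebra.
   The topology on matrices is the product topology, i.e. the Euclidean one. *)
HB.instance Definition _ (R : realType) (m n : nat) :=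
  @isMeasurable.Build (sigma_display (@open 'M[R]_(m, n))) 'M[R]_(m, n)
    <<s @open 'M[R]_(m, n) >> (@sigma_algebra0 _ setT _)
    (@sigma_algebraC _ _) (@sigma_algebra_bigcup _ setT _).

Section euclidean.
Context {R : realType} {d : nat}.
Implicit Types u v s : 'cV[R]_d.

Definition dot u v : R := \sum_(i < d) u i 0 * v i 0.

(* The norm `|u| provided by the library is the sup norm. *)
Definition enorm u : R := Num.sqrt (dot u u).

Definition orthant : set 'cV[R]_d := [set s | forall i, 0 <= s i 0].

Definition reproducing_kernel (k : 'cV[R]_d -> 'cV[R]_d -> R) : Prop :=
  (forall x y, k x y = k y x) /\
  (forall (n : nat) (z : 'I_n -> 'cV[R]_d) (c : 'I_n -> R),
     0 <= \sum_(i < n) \sum_(j < n) c i * c j * k (z i) (z j)).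

End euclidean.

Arguments orthant {R d}.

Section thorin.
Context {R : realType} {d : nat}.
Variable nu : {measure set 'cV[R]_d -> \bar R}.

Definition radon_measure : Prop :=
  (forall K : set 'cV[R]_d, compact K -> (nu K < +oo)%E) /\
  (forall A : set 'cV[R]_d, measurable A ->
     nu A = ereal_sup [set nu K | K in [set K | compact K /\ K `<=` A]]).

(* A measure on the closed orthant is encoded as a measure on R^d which does
   not charge the complement of the orthant.  The logarithm is the extended
   one, with lne 0 = -oo, so that a Thorin measure has no mass at 0. *)
Definition thorin_measure : Prop :=
  [/\ radon_measure,
      nu (~` orthant) = 0%E,
      (\int[nu]_(s in orthant `&` [set s | (enorm s <= 1)%R])
         `| lne (enorm s)%:E | < +oo)%E &
      (\int[nu]_(s in orthant `&` [set s | (1 < enorm s)%R])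
         ((enorm s)^-1)%:E < +oo)%E].

End thorin.

Section complex_functions.
Context {R : realType}.

Definition cexp (z : R[i]) : R[i] :=
  (expR (complex.Re z))%:C * (cos (complex.Im z) +i* sin (complex.Im z)).

Definition cmod (z : R[i]) : R :=
  Num.sqrt (complex.Re z ^+ 2 + complex.Im z ^+ 2).

(* Principal argument, in ]-pi, pi] for z != 0. *)
Definition carg (z : R[i]) : R :=
  if 0 <= complex.Im z then acos (complex.Re z / cmod z)
  else - acos (complex.Re z / cmod z).

Definition clog (z : R[i]) : R[i] := ln (cmod z) +i* carg z.

Definition cintegral {dT} {T : measurableType dT}
    (mu : {measure set T -> \bar R}) (D : set T) (f : T -> R[i]) : R[i] :=
  (\int[mu]_(x in D) complex.Re (f x)) +i* (\int[mu]_(x in D) complex.Im (f x)).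

(* psi is log phi, the logarithm of a characteristic function phi on R^d being
   the continuous one that vanishes at 0. *)
Definition is_log_of {d : nat} (phi psi : 'cV[R]_d -> R[i]) : Prop :=
  [/\ continuous (fun t => complex.Re (psi t)),
      continuous (fun t => complex.Im (psi t)),
      psi 0 = 0 &
      forall t, cexp (psi t) = phi t].

End complex_functions.

Section random_vectors.
Context {R : realType} {d : nat} {dO : measure_display}
  {Omega : measurableType dO}.
Variable P : probability Omega R.

Definition characteristic_function (X : {RV P >-> 'cV[R]_d}) (t : 'cV[R]_d) :
    R[i] :=
  cintegral P setT (fun w => cexp (0 +i* dot t (X w))).

Definition thorin_law (nu : {measure set 'cV[R]_d -> \bar R})
    (X : {RV P >-> 'cV[R]_d}) : Prop :=
  (forall w, orthant (X w)) /\
  is_log_of (characteristic_function X)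
    (fun t => - cintegral nu orthant (fun s => clog (1 -i* dot s t))).

Definition exp1_law (E : {RV P >-> R}) : Prop :=
  forall A : set R, measurable A -> distribution P E A = exponential_prob 1 A.

(* Joint independence; taking some of the sets to be setT gives the pairwise
   statements. *)
Definition independent3 (X : {RV P >-> 'cV[R]_d}) (E E' : {RV P >-> R}) : Prop :=
  forall (A : set 'cV[R]_d) (B C : set R),
    measurable A -> measurable B -> measurable C ->
    P (X @^-1` A `&` E @^-1` B `&` E' @^-1` C) =
    (P (X @^-1` A) * P (E @^-1` B) * P (E' @^-1` C))%E.

Definition mean (f : Omega -> R) : R := fine 'E_P[f].

End random_vectors.

Section stein.
Context {R : realType} {d : nat}.

(* The library's exponential_prob 1, packed as a probability. *)
Definition exp1 : probability (measurableTypeR R) R :=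
  exponential_distribution_exponential_prob__canonical__probability_measure_Probability
    (ltr01 : (0 : R) < 1).

Variable nu : {measure set 'cV[R]_d -> \bar R}.

Definition stein_op (f : 'cV[R]_d -> 'cV[R]_d) (x : 'cV[R]_d) : R :=
  dot x (f x) -
  \int[nu]_(s in orthant) mean exp1 (fun e => dot s (f (x + e *: s))).

Definition stein_kernel (K : 'cV[R]_d -> 'cV[R]_d -> 'M[R]_d)
    (x y : 'cV[R]_d) : R :=
  let Phi x' y' := \col_(j < d) stein_op (fun z => col j (K x' z)) y' in
  stein_op (fun z => Phi z y) x.

(* Absolute convergence of the integrals defining the Stein kernel of k I_d at
   (x, y).  On the orthant dot s' s >= 0. *)
Definition stein_integrable (k : 'cV[R]_d -> 'cV[R]_d -> R)
    (x y : 'cV[R]_d) : Prop :=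
  [/\ (\int[nu]_(s in orthant) \int[exp1]_e
         (enorm s * `|k x (y + e *: s)|)%:E < +oo)%E,
      (\int[nu]_(s' in orthant) \int[exp1]_e'
         (enorm s' * `|k (x + e' *: s') y|)%:E < +oo)%E &
      (\int[nu]_(s' in orthant) \int[nu]_(s in orthant)
         \int[exp1]_e' \int[exp1]_e
         (dot s' s * `|k (x + e' *: s') (y + e *: s)|)%:E < +oo)%E].

End stein.

(* Main.v *)
From HB Require Import structures.
Require Import Defs.
From mathcomp Require Import all_boot all_order all_algebra.
From mathcomp Require Import all_classical all_reals all_analysis.
From mathcomp Require Import measurable_realfun.
Set Implicit Arguments.
Unset Strict Implicit.
Unset Printing Implicit Defensive.
Import Order.TTheory GRing.Theory Num.Theory.
Import numFieldNormedType.Exports.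
Local Open Scope classical_set_scope.
Local Open Scope ring_scope.

(** The Stein operator is linear in the vector field and, on a multiple of a
basis vector, reads one coordinate: <s, c e_j> = s_j c.  Applying it twice to
k(x, y) I_d therefore produces the four terms of the formula immediately,
except that
- the term in x and s comes out as a sum over coordinates of integrals of
  s_j E[k(x, y + s E)], and
- the double term comes out in the wrong order: the outer integral and
  expectation, over s' and E', surround a whole Stein integral over s and E,
  again split into coordinates, and still form a single integral with the term
  in s' and y.
The first point is linearity of the integral.  The second one is Fubini's
theorem exchanging E' with s at fixed s', applied to each coordinate
s'_j s_j k(x + s' E', y + s E).  On the orthant the weights s'_j s_j are
nonnegative and bounded by <s', s>, so that the absolute convergence of the double integral
gives the integrability required, for almost every s'
([ae_mean_thorin_average], based on [Rintegral_exchange_product]).  The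
exponential law is then replaced by the joint law of (E', E), a product by
independence.

Integrals here are real numbers, and an integral that diverges has the value 0.
Constants therefore come out of every integral of a measurable function, which
lets the coordinates be handled without deciding where they vanish.

Fubini's theorem needs a sigma-finite measure and jointly measurable integrands.
A Thorin measure with a first moment is sigma-finite because it is finite on the
origin, which is compact, and on the sets where the norm is at least 1/(n + 1), by
Markov's inequality.  Joint measurability of k(x + e' s', y + e s) follows from
that of k, since a map into R^d is Borel as soon as its coordinates are: an open
set is a countable union of rational boxes.

When nu is a finite sum of weighted Dirac masses, each integral against nu is
the corresponding weighted sum of values. *)

(** * Integrals with real values *)

Section real_integral.
Context d (T : measurableType d) (R : realType).
Variable mu : {measure set T -> \bar R}.
Implicit Types (D : set T) (f g : T -> R).

(** The extended integral of a measurable function that is not integrable is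
infinite, and [fine] sends both infinities to 0. *)
Lemma Rintegral_nonintegrable D f : measurable D -> measurable_fun D f ->
  ~ mu.-integrable D (EFin \o f) -> \int[mu]_(x in D) f x = 0.
Proof.
move=> mD mf nf; rewrite /Rintegral.
have mEf : measurable_fun D (EFin \o f) by exact/measurable_EFinP.
have [fin|] := boolP ((\int[mu]_(x in D) (f x)%:E)%E \is a fin_num); last first.
  by rewrite fin_numE negb_and !negbK => /orP[] /eqP ->.
exfalso; apply: nf; apply/integrableP; split=> //.
by rewrite (integral_fin_num_abs mu mD mf).
Qed.

(** If f is not integrable then neither is r f for r != 0, and both sides are 0. *)
Lemma measurable_RintegralZl D f r : measurable D -> measurable_fun D f ->
  \int[mu]_(x in D) (r * f x) = r * \int[mu]_(x in D) f x.
Proof.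
move=> mD mf; have [->|r0] := eqVneq r 0.
  rewrite mul0r; under eq_Rintegral do rewrite mul0r.
  by rewrite Rintegral_cst// mul0r.
have [fi|nfi] := pselect (mu.-integrable D (EFin \o f)).
  exact: RintegralZl.
rewrite !Rintegral_nonintegrable ?mulr0//; first exact: measurable_funM.
move=> rfi; apply: nfi.
have := integrableZl mD r^-1 rfi; apply: eq_integrable => // x _ /=.
by rewrite -EFinM mulKf.
Qed.

(** The right-hand side stays an extended real, so that the bound also makes sense
(and is trivial) when f is not integrable. *)
Lemma le_abs_Rintegral D f : measurable D -> measurable_fun D f ->
  (`|\int[mu]_(x in D) f x|%:E <= \int[mu]_(x in D) `|f x|%:E)%E.
Proof.
move=> mD mf; have mEf : measurable_fun D (EFin \o f) by exact/measurable_EFinP.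
have [fi|nfi] := pselect (mu.-integrable D (EFin \o f)).
  by rewrite EFin_normr_Rintegral//; exact: le_abse_integral.
by rewrite Rintegral_nonintegrable// normr0; exact: integral_ge0.
Qed.

Lemma ae_eq_Rintegral D f g : measurable D ->
  measurable_fun D f -> measurable_fun D g ->
  {ae mu, forall x, D x -> f x = g x} ->
  \int[mu]_(x in D) f x = \int[mu]_(x in D) g x.
Proof.
move=> mD mf mg fg; congr fine; apply: ae_eq_integral => //.
- exact/measurable_EFinP.
- exact/measurable_EFinP.
- by apply: filterS fg => x fg Dx /=; rewrite fg.
Qed.

Lemma Rintegral_sum D (I : Type) (s : seq I) (F : I -> T -> R) : measurable D ->
  (forall i, mu.-integrable D (EFin \o F i)) ->
  \int[mu]_(x in D) (\sum_(i <- s) F i x) = \sum_(i <- s) \int[mu]_(x in D) F i x.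
Proof.
move=> mD Fi; elim: s => [|i s IH].
  under eq_Rintegral do rewrite big_nil.
  by rewrite big_nil Rintegral_cst// mul0r.
under eq_Rintegral do rewrite big_cons.
rewrite big_cons RintegralD//; first by rewrite IH.
apply: (eq_integrable mD (fun x => \sum_(i <- s) (F i x)%:E)%E).
  by move=> x _ /=; rewrite sumEFin.
by apply: integrable_sum => // j _; exact: Fi.
Qed.

Lemma integrable_lty D f : measurable D -> measurable_fun D f ->
  (\int[mu]_(x in D) `|f x|%:E < +oo)%E -> mu.-integrable D (EFin \o f).
Proof.
by move=> mD mf foo; apply/integrableP; split=> //; exact/measurable_EFinP.
Qed.

Lemma ae_lty D (g : T -> \bar R) : measurable D -> measurable_fun D g ->
  (forall x, D x -> 0 <= g x)%E -> (\int[mu]_(x in D) g x < +oo)%E ->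
  {ae mu, forall x, D x -> (g x < +oo)%E}.
Proof.
move=> mD mg g0 goo; have : mu.-integrable D g.
  apply/integrableP; split=> //.
  by under eq_integral => x /[!inE] Dx do rewrite gee0_abs ?g0//.
move=> /(integrable_ae mD); apply: filterS => x gx Dx.
by rewrite -ge0_fin_numE ?g0//; exact: gx.
Qed.

End real_integral.

(** * Integrals with parameters and Fubini's theorem *)

Section product_integral.
Context d1 d2 (T1 : measurableType d1) (T2 : measurableType d2) (R : realType).

(** Tonelli's theorem gives the measurability of the integrals of the positive and
negative parts.  Their difference and [fine] are measurable, so that the
statement holds even for parameters at which the integral diverges. *)
Lemma measurable_Rintegral (m2 : {sigma_finite_measure set T2 -> \bar R})
    (D : set T2) (F : T1 * T2 -> R) : measurable D -> measurable_fun setT F ->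
  measurable_fun setT (fun x => \int[m2]_(y in D) F (x, y)).
Proof.
move=> mD mF; pose G := (EFin \o F) \_ (setT `*` D).
have mTD : measurable (@setT T1 `*` D) by exact: measurableX.
have mG : measurable_fun setT G.
  apply: (measurable_restrictT _ mTD).1; apply: measurable_funTS.
  exact/measurable_EFinP.
have -> : (fun x => \int[m2]_(y in D) F (x, y)) =
    fine \o (fun x => \int[m2]_y G (x, y))%E.
  apply/funext => x /=; rewrite /Rintegral integral_mkcond; congr fine.
  by apply: eq_integral => y _; rewrite /G !patchE in_setX in_setT.
apply: measurableT_comp; first exact: fine_measurable measurableT.
have -> : (fun x => \int[m2]_y G (x, y))%E =
    (fun x => \int[m2]_y (G^\+)%E (x, y) - \int[m2]_y (G^\-)%E (x, y))%E.
  apply/funext => x; rewrite [LHS]integralE.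
  by congr (_ - _)%E; apply: eq_integral => y _; rewrite ?funeposE ?funenegE.
apply: emeasurable_funB.
  apply: (measurable_fun_fubini_tonelli_F (G^\+)%E) => //.
  exact: measurable_funepos.
apply: (measurable_fun_fubini_tonelli_F (G^\-)%E) => //.
exact: measurable_funeneg.
Qed.

Lemma measurable_ge0_integral (m2 : {sigma_finite_measure set T2 -> \bar R})
    (D : set T2) (F : T1 * T2 -> \bar R) : measurable D ->
  measurable_fun setT F -> (forall x y, D y -> 0 <= F (x, y))%E ->
  measurable_fun setT (fun x => \int[m2]_(y in D) F (x, y))%E.
Proof.
move=> mD mF F0; pose G := F \_ (setT `*` D).
have mG : measurable_fun setT G.
  by apply: (measurable_restrictT _ _).1; [exact: measurableX|exact: measurable_funTS].
have -> : (fun x => \int[m2]_(y in D) F (x, y))%E =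
    (fun x => \int[m2]_y G (x, y))%E.
  apply/funext => x /=; rewrite integral_mkcond.
  by apply: eq_integral => y _; rewrite /G !patchE in_setX in_setT.
apply: (measurable_fun_fubini_tonelli_F G) => // -[x y].
rewrite /G patchE in_setX in_setT /=; case: ifPn => // /set_mem; exact: F0.
Qed.

(** The inner integral is finite for almost every x only; elsewhere its real value
is 0, which does not change the outer integral. *)
Lemma Rintegral12_prod (m1 : {sigma_finite_measure set T1 -> \bar R})
    (m2 : {sigma_finite_measure set T2 -> \bar R}) (F : T1 * T2 -> R) :
  (m1 \x m2)%E.-integrable setT (EFin \o F) ->
  \int[m1]_x \int[m2]_y F (x, y) = \int[(m1 \x m2)%E]_z F z.
Proof.
move=> iF; have mF : measurable_fun setT F.
  by apply/measurable_EFinP; exact: measurable_int iF.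
rewrite /Rintegral -(integral12_prod_meas1 iF); congr fine.
apply: ae_eq_integral => //.
- apply/measurable_EFinP; exact: measurable_Rintegral.
- exact: (measurable_fubini_F iF).
- apply: filterS (ae_integrable1 iF) => x iFx _ /=.
  by rewrite fineK//; exact: integrable_fin_num.
Qed.

End product_integral.

Lemma measurable_swap d1 d2 (T1 : measurableType d1) (T2 : measurableType d2) :
  measurable_fun setT (fun z : T1 * T2 => (z.2, z.1)).
Proof. by apply: measurable_fun_pair. Qed.

(** Fubini's theorem on the product of the whole first space with D, obtained by
extending F by 0 outside that set. *)
Lemma Rintegral_exchange d1 d2 (T1 : measurableType d1) (T2 : measurableType d2)
    (R : realType) (m1 : {sigma_finite_measure set T1 -> \bar R})
    (m2 : {sigma_finite_measure set T2 -> \bar R}) (D : set T2)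
    (F : T1 * T2 -> R) : measurable D -> measurable_fun setT F ->
  (\int[m2]_(y in D) \int[m1]_x `|F (x, y)|%:E < +oo)%E ->
  m1.-integrable setT (EFin \o (fun x => \int[m2]_(y in D) F (x, y))) /\
  \int[m1]_x \int[m2]_(y in D) F (x, y) =
  \int[m2]_(y in D) \int[m1]_x F (x, y).
Proof.
move=> mD mF foo; pose G := F \_ (setT `*` D).
have mG : measurable_fun setT G.
  by apply: (measurable_restrictT _ _).1; [exact: measurableX|exact: measurable_funTS].
have GE x y : G (x, y) = if y \in D then F (x, y) else 0.
  by rewrite /G patchE in_setX in_setT.
have iG : (m1 \x m2)%E.-integrable setT (EFin \o G).
  apply/integrable21ltyP; first exact/measurable_EFinP.
  apply: le_lt_trans foo; rewrite [leRHS]integral_mkcond.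
  rewrite le_eqVlt; apply/orP; left; apply/eqP; apply: eq_integral => y _.
  rewrite patchE; case: ifPn => yD.
    by apply: eq_integral => x _ /=; rewrite GE yD.
  by apply: integral0_eq => x _ /=; rewrite GE (negbTE yD) /= normr0.
have GD x : \int[m2]_(y in D) F (x, y) = \int[m2]_y G (x, y).
  rewrite Rintegral_mkcond; apply: eq_Rintegral => y _.
  by rewrite GE patchE.
have DG : \int[m2]_(y in D) \int[m1]_x F (x, y) = \int[m2]_y \int[m1]_x G (x, y).
  rewrite Rintegral_mkcond; apply: eq_Rintegral => y _.
  rewrite patchE; case: ifPn => yD.
    by apply: eq_Rintegral => x _; rewrite GE yD.
  under eq_Rintegral do rewrite GE (negbTE yD).
  by rewrite Rintegral_cst// mul0r.
split.
  apply: (eq_integrable measurableT (EFin \o (fun x => \int[m2]_y G (x, y)))).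
    by move=> x _ /=; rewrite GD.
  apply: integrable_lty => //; first exact: (@measurable_Rintegral _ _ _ _ _ m2 setT).
  have := (integrable12ltyP _ _ (measurable_int _ iG)).1 iG.
  apply: le_lt_trans; apply: ge0_le_integral => //.
  - apply/measurable_EFinP; apply: measurableT_comp => //.
    exact: (@measurable_Rintegral _ _ _ _ _ m2 setT).
  - apply: (@measurable_ge0_integral _ _ _ _ _ m2 setT
      (fun z => `|(EFin \o G) z|%E)) => //.
    by apply: measurableT_comp => //; exact/measurable_EFinP.
  - move=> x _; apply: le_abs_Rintegral => //.
    exact: measurable_fun_pair2.
rewrite DG; under eq_Rintegral do rewrite GD.
rewrite Rintegral12_prod//.
rewrite /Rintegral -(integral21_prod_meas1 iG); congr fine.
apply: ae_eq_integral => //.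
- exact: measurable_fubini_G iG.
- apply/measurable_EFinP.
  apply: (@measurable_Rintegral _ _ _ _ _ m1 setT (fun z => G (z.2, z.1))) => //.
  exact: measurableT_comp mG (@measurable_swap _ _ _ _).
- apply: filterS (ae_integrable2 iG) => y iGy _ /=.
  by rewrite fineK//; exact: integrable_fin_num.
Qed.

(** The shape of Fubini's theorem that the double term of the Stein kernel needs:
the variable u is outermost on the left, and joins v under a single integral
over the product space on the right, inside the integral over s.  The weight w
stays outside the inner integrals, as it does in the Stein operator. *)
Lemma Rintegral_exchange_product d0 d1 d2 (T : measurableType d0)
    (U1 : measurableType d1) (U2 : measurableType d2) (R : realType)
    (nu : {sigma_finite_measure set T -> \bar R})
    (m1 : probability U1 R) (m2 : probability U2 R)
    (D : set T) (w : T -> R) (F : T * (U1 * U2) -> R) :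
  measurable D -> measurable_fun setT w -> measurable_fun setT F ->
  (\int[nu]_(s in D) \int[m1]_u \int[m2]_v `|w s * F (s, (u, v))|%:E < +oo)%E ->
  [/\ m1.-integrable setT
        (EFin \o (fun u => \int[nu]_(s in D) (w s * \int[m2]_v F (s, (u, v))))),
      nu.-integrable D
        (EFin \o (fun s => w s * \int[(m1 \x m2)%E]_z F (s, z))) &
      \int[m1]_u \int[nu]_(s in D) (w s * \int[m2]_v F (s, (u, v))) =
      \int[nu]_(s in D) (w s * \int[(m1 \x m2)%E]_z F (s, z))].
Proof.
move=> mD mw mF foo.
pose F' z := w z.1 * F z.
have mF' : measurable_fun setT F'.
  by apply: measurable_funM => //; exact: measurableT_comp.
have mF'2 : measurable_fun setT (fun z : (U1 * T) * U2 => F' (z.1.2, (z.1.1, z.2))).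
  apply: (measurableT_comp mF'); apply: measurable_fun_pair.
    by apply: (measurableT_comp measurable_snd); exact: measurable_fst.
  apply: measurable_fun_pair => //.
  by apply: (measurableT_comp measurable_fst); exact: measurable_fst.
pose Q (z : U1 * T) := \int[m2]_v F' (z.2, (z.1, v)).
have mQ : measurable_fun setT Q.
  exact: (@measurable_Rintegral _ _ _ _ _ m2 setT
    (fun z : (U1 * T) * U2 => F' (z.1.2, (z.1.1, z.2)))).
have QE u s : w s * \int[m2]_v F (s, (u, v)) = Q (u, s).
  rewrite -measurable_RintegralZl//.
  exact: measurable_fun_pair2 (measurable_fun_pair2 _ mF).
have mabs : measurable_fun setT (fun z : (U1 * T) * U2 =>
    `|F' (z.1.2, (z.1.1, z.2))|%:E).
  by apply/measurable_EFinP; exact: measurableT_comp.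
have mA : measurable_fun setT
    (fun z : U1 * T => \int[m2]_v `|F' (z.2, (z.1, v))|%:E)%E.
  exact: (@measurable_ge0_integral _ _ _ _ _ m2 setT
    (fun z : (U1 * T) * U2 => `|F' (z.1.2, (z.1.1, z.2))|%:E)).
have mB : measurable_fun setT
    (fun s => \int[m1]_u \int[m2]_v `|F' (s, (u, v))|%:E)%E.
  apply: (@measurable_ge0_integral _ _ _ _ _ m1 setT
    (fun z : T * U1 => \int[m2]_v `|F' (z.1, (z.2, v))|%:E)%E) => //.
    exact: (measurableT_comp mA (@measurable_swap _ _ _ _)).
  by move=> *; exact: integral_ge0.
have mF's s : measurable_fun setT (fun z => F' (s, z)).
  exact: measurable_fun_pair2.
have Qoo : (\int[nu]_(s in D) \int[m1]_u `|Q (u, s)|%:E < +oo)%E.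
  apply: le_lt_trans foo; apply: ge0_le_integral => //.
  - by move=> *; exact: integral_ge0.
  - apply: measurable_funTS.
    apply: (@measurable_ge0_integral _ _ _ _ _ m1 setT
      (fun z : T * U1 => `|Q (z.2, z.1)|%:E)) => //.
    apply/measurable_EFinP; apply: measurableT_comp => //.
    exact: (measurableT_comp mQ (@measurable_swap _ _ _ _)).
  - exact: measurable_funTS.
  - move=> s _; apply: ge0_le_integral => //.
    + apply/measurable_EFinP; apply: measurableT_comp => //.
      exact: measurable_fun_pair1.
    + exact: measurable_fun_pair1 mA.
    + move=> u _; apply: le_abs_Rintegral => //.
      exact: measurable_fun_pair2 (mF's s).
have [iQ EQ] := Rintegral_exchange mD mQ Qoo.
have mp : measurable_fun setT (fun s => \int[(m1 \x m2)%E]_z F' (s, z)).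
  exact: (@measurable_Rintegral _ _ T (U1 * U2)%type R
    [the probability (U1 * U2)%type R of (m1 \x m2)%E]
    setT F' measurableT mF').
have pE s : w s * \int[(m1 \x m2)%E]_z F (s, z) = \int[(m1 \x m2)%E]_z F' (s, z).
  by rewrite -measurable_RintegralZl//; exact: measurable_fun_pair2.
have tonelli s : (\int[(m1 \x m2)%E]_z `|F' (s, z)|%:E =
    \int[m1]_u \int[m2]_v `|F' (s, (u, v))|%:E)%E.
  rewrite (@fubini_tonelli1 _ _ _ _ _ m1 m2 (fun z => `|F' (s, z)|%:E))//.
  by apply/measurable_EFinP; exact: measurableT_comp.
split.
- apply: eq_integrable iQ => // u _ /=.
  by congr EFin; apply: eq_Rintegral => s _; rewrite QE.
- have ip : nu.-integrable D (EFin \o (fun s => \int[(m1 \x m2)%E]_z F' (s, z))).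
    apply: integrable_lty => //; first exact: measurable_funTS.
    apply: le_lt_trans foo; apply: ge0_le_integral => //.
    + by apply/measurable_EFinP/measurable_funTS; exact: measurableT_comp.
    + exact: measurable_funTS.
    + by move=> s _; rewrite -tonelli; exact: le_abs_Rintegral.
  by apply: eq_integrable ip => // s _ /=; rewrite pE.
- under eq_Rintegral do under eq_Rintegral do rewrite QE.
  rewrite EQ; under [RHS]eq_Rintegral do rewrite pE.
  apply: ae_eq_Rintegral => //.
  + apply: measurable_funTS.
    apply: (@measurable_Rintegral _ _ _ _ _ m1 setT
      (fun z : T * U1 => Q (z.2, z.1))) => //.
    exact: (measurableT_comp mQ (@measurable_swap _ _ _ _)).
  + exact: measurable_funTS.
  + have ge0 s : D s -> (0 <= \int[m1]_u \int[m2]_v `|F' (s, (u, v))|%:E)%E.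
      by move=> _; apply: integral_ge0 => u _; exact: integral_ge0.
    have := ae_lty mD (measurable_funTS mB) ge0 foo; apply: filterS => s Fs Ds.
    rewrite -Rintegral12_prod//; apply/integrable12ltyP; last exact: Fs.
    exact/measurable_EFinP.
Qed.

(** In the Stein kernel w is a coordinate of s or <s, y>, both dominated by a
multiple of the norm b.  The second part keeps w inside because F itself need
not be integrable where b vanishes. *)
Lemma integrable_weighted d1 d2 (T : measurableType d1) (V : measurableType d2)
    (R : realType) (nu : {sigma_finite_measure set T -> \bar R})
    (m : {sigma_finite_measure set V -> \bar R}) (D : set T) (b w : T -> R) (c : R)
    (F : T * V -> R) :
  measurable D -> measurable_fun setT b -> measurable_fun setT w ->
  measurable_fun setT F ->
  0 <= c -> (forall s, 0 <= b s) -> (forall s, D s -> `|w s| <= c * b s) ->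
  (\int[nu]_(s in D) \int[m]_v (b s * `|F (s, v)|)%:E < +oo)%E ->
  nu.-integrable D (EFin \o (fun s => w s * \int[m]_v F (s, v))) /\
  {ae nu, forall s, D s -> m.-integrable setT (EFin \o (fun v => w s * F (s, v)))}.
Proof.
move=> mD mb mw mF c0 b0 wb foo.
have mFs s : measurable_fun setT (fun v => F (s, v)) by exact: measurable_fun_pair2.
have mbF : measurable_fun setT (fun z : T * V => (b z.1 * `|F z|)%:E).
  apply/measurable_EFinP; apply: measurable_funM; exact: measurableT_comp.
have mh : measurable_fun setT (fun s => \int[m]_v (b s * `|F (s, v)|)%:E)%E.
  apply: (@measurable_ge0_integral _ _ _ _ _ m setT
    (fun z : T * V => (b z.1 * `|F z|)%:E)) => // s v _.
  by rewrite lee_fin mulr_ge0.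
have h0 s : D s -> (0 <= \int[m]_v (b s * `|F (s, v)|)%:E)%E.
  by move=> _; apply: integral_ge0 => v _; rewrite lee_fin mulr_ge0.
have wF s : D s -> (\int[m]_v `|w s * F (s, v)|%:E <=
    c%:E * \int[m]_v (b s * `|F (s, v)|)%:E)%E.
  move=> Ds; rewrite -ge0_integralZl//; last 2 first.
  - exact: (measurable_fun_pair2 s mbF).
  - by move=> v _; rewrite lee_fin mulr_ge0.
  apply: ge0_le_integral => //.
  - by apply/measurable_EFinP; apply: measurableT_comp => //; exact: measurable_funM.
  - apply: measurable_funeM; exact: (measurable_fun_pair2 s mbF).
  - move=> v _; rewrite -EFinM lee_fin normrM mulrA ler_wpM2r//; exact: wb.
split.
  apply: integrable_lty => //.
    apply: measurable_funTS; apply: measurable_funM => //.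
    exact: (@measurable_Rintegral _ _ _ _ _ m setT).
  apply: (@le_lt_trans _ _ 
    (\int[nu]_(s in D) (c%:E * \int[m]_v (b s * `|F (s, v)|)%:E))%E).
    apply: ge0_le_integral => //.
    - apply/measurable_EFinP; apply: measurableT_comp => //.
      apply: measurable_funTS; apply: measurable_funM => //.
      exact: (@measurable_Rintegral _ _ _ _ _ m setT).
    - by apply: measurable_funTS; exact: measurable_funeM.
    - move=> s Ds; apply: le_trans (wF _ Ds).
      rewrite -measurable_RintegralZl//; apply: le_abs_Rintegral => //.
      exact: measurable_funM.
  rewrite ge0_integralZl//; last exact: measurable_funTS.
  by apply: lte_mul_pinfty => //; rewrite lee_fin.
have := ae_lty mD (measurable_funTS mh) h0 foo; apply: filterS => s hs Ds.
apply: integrable_lty => //; first exact: measurable_funM.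
apply: le_lt_trans (wF _ Ds) _.
by apply: lte_mul_pinfty => //; exact: hs.
Qed.

(** * Image measures and atomic measures *)

Section change_of_law.
Context d1 d2 (X : measurableType d1) (Y : measurableType d2) (R : realType).
Variables (mu : {measure set X -> \bar R}) (m : {measure set Y -> \bar R}).
Variable phi : X -> Y.

(** The change of variables holds for the positive and negative parts separately;
hence it also holds for functions that are not integrable. *)
Lemma Rintegral_law (f : Y -> R) : measurable_fun setT phi ->
  (forall A, measurable A -> mu (phi @^-1` A) = m A) ->
  measurable_fun setT f ->
  \int[mu]_x f (phi x) = \int[m]_y f y.
Proof.
move=> mphi law mf; rewrite /Rintegral; congr fine.
have mEf : measurable_fun setT (EFin \o f) by exact/measurable_EFinP.
have ge0 (g : Y -> \bar R) : measurable_fun setT g -> (forall y, 0 <= g y)%E ->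
    (\int[mu]_x g (phi x) = \int[m]_y g y)%E.
  move=> mg g0; transitivity (\int[pushforward mu phi]_y g y)%E.
    by rewrite ge0_integral_pushforward.
  by apply: eq_measure_integral => A mA _; rewrite -law.
rewrite [LHS]integralE [RHS]integralE; congr (_ - _)%E.
  rewrite -(ge0 (EFin \o f)^\+%E) => [||y]; rewrite ?funepos_ge0//.
    by apply: eq_integral => x _; rewrite !funeposE.
  exact: measurable_funepos.
rewrite -(ge0 (EFin \o f)^\-%E) => [||y]; rewrite ?funeneg_ge0//.
  by apply: eq_integral => x _; rewrite !funenegE.
exact: measurable_funeneg.
Qed.

End change_of_law.

(** The atoms a_j may coincide, so nu is treated as a sum of measures instead of
being restricted to the set of its atoms. *)
Lemma Rintegral_atoms d (T : measurableType d) (R : realType)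
    (nu : {measure set T -> \bar R})
    (D : set T) (n : nat) (alpha : 'I_n -> R) (a : 'I_n -> T) (f : T -> R) :
  measurable D -> measurable_fun setT f ->
  (forall j, 0 <= alpha j) -> (forall j, D (a j)) ->
  (forall A : set T, measurable A ->
     nu A = (\sum_(j < n) (alpha j)%:E * \d_(a j) A)%E) ->
  \int[nu]_(s in D) f s = \sum_(j < n) alpha j * f (a j).
Proof.
move=> mD mf alpha0 Da nuE.
(* Sums of measures are taken along sequences: the family is completed by the
   zero measure. *)
pose m_ (i : nat) : {measure set T -> \bar R} :=
  if insub i is Some j then mscale (NngNum (alpha0 j)) \d_(a j) else mzero.
have m_E (j : 'I_n) : m_ j = mscale (NngNum (alpha0 j)) \d_(a j).
  by rewrite /m_ valK.
have ge0 (g : T -> \bar R) : measurable_fun setT g -> (forall s, 0 <= g s)%E ->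
    (\int[nu]_(s in D) g s = \sum_(j < n) (alpha j)%:E * g (a j))%E.
  move=> mg g0; rewrite (eq_measure_integral (msum m_ n)); last first.
    move=> A mA _; rewrite nuE// /msum.
    by apply: eq_bigr => j _; rewrite m_E.
  rewrite ge0_integral_measure_sum//; last exact: measurable_funTS.
  apply: eq_bigr => j _; rewrite m_E ge0_integral_mscale//; last first.
    exact: measurable_funTS.
  rewrite integral_dirac//; last exact: measurable_funTS.
  by rewrite diracE mem_set// mul1e.
rewrite /Rintegral integralE.
have mEf : measurable_fun setT (EFin \o f) by exact/measurable_EFinP.
rewrite (ge0 (EFin \o f)^\+%E) //; last exact: measurable_funepos.
rewrite (ge0 (EFin \o f)^\-%E) //; last exact: measurable_funeneg.
under eq_bigr do rewrite funeposE -EFin_max -EFinM.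
under [X in (_ - X)%E]eq_bigr do rewrite funenegE -EFinN -EFin_max -EFinM.
rewrite !sumEFin -EFinB /= -sumrB; apply: eq_bigr => j _.
rewrite -mulrBr; congr (_ * _).
case/orP: (le_total 0 (f (a j))) => f0.
  by rewrite max_l// max_r ?oppr_le0// subr0.
by rewrite max_r// max_l ?oppr_ge0// sub0r opprK.
Qed.

(** * Borel measurability in spaces of matrices *)

Section matrix_measurability.
Context {R : realType} {m n : nat}.

Lemma open_measurable_mx (A : set 'M[R]_(m, n)) : open A -> measurable A.
Proof. by move=> oA; exact: sub_sigma_algebra. Qed.

Lemma measurable_coord (i : 'I_m) (j : 'I_n) :
  measurable_fun setT (fun M : 'M[R]_(m, n) => M i j).
Proof.
apply: (measurability _ (RGenOpens.measurableE R)) => _ [_ [a [b ->] <-]].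
have oB : open `]a, b[%classic by exact: interval_open.
rewrite setTI; apply: open_measurable_mx.
by apply: open_comp => // M _; exact: coord_continuous.
Qed.

Let box (p : 'M[rat]_(m, n) * nat) : set 'M[R]_(m, n) :=
  [set M | forall i j, `|M i j - ratr (p.1 i j)| < p.2.+1%:R^-1].

(** Around M one takes the box of radius 1/(N + 1) < e / 2 centred at a rational
matrix within 1/(N + 1) of M: it contains M and lies in the ball of radius e. *)
Lemma open_bigcup_boxes (A : set 'M[R]_(m, n)) : open A ->
  A = \bigcup_(p in [set p | box p `<=` A]) box p.
Proof.
move=> oA; apply/seteqP; split=> [M AM|M [p /= sA]]; last exact: sA.
have : nbhs M A by exact: open_nbhs_nbhs.
rewrite -nbhs_ballE => -[e /= e0 eA].
have [N _ Ne] : exists2 N : nat, True & N.+1%:R^-1 < e / 2 :> R.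
  have e2 : 0 < e / 2 by rewrite divr_gt0.
  have [N _ Ne] := near_infty_natSinv_lt (PosNum e2).
  by exists N => //; apply: Ne => /=.
have rat_near (x : R) : exists q : rat, `|x - ratr q| < N.+1%:R^-1.
  have [|q] := @rat_in_itvoo R (x - N.+1%:R^-1) (x + N.+1%:R^-1).
    by rewrite ltrBlDr -addrA ltrDl addr_gt0// invr_gt0.
  by rewrite in_itv/= => xq; exists q; rewrite distrC ltr_distl.
pose q := \matrix_(i, j) xchoose (rat_near (M i j)).
exists (q, N) => [M' /= M'q|i j] /=; last first.
  by rewrite /q mxE; exact: (xchooseP (rat_near (M i j))).
apply: eA; split=> // i j; rewrite /ball/=.
have := M'q i j; rewrite /q mxE; have := xchooseP (rat_near (M i j)).
move: (xchoose _) => r Mr M'r.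
rewrite (splitr e) -[_ - _](subrKA (ratr r)) (le_lt_trans (ler_normD _ _))//.
by rewrite ltrD// ?(lt_trans Mr)// distrC (lt_trans M'r).
Qed.

(** It suffices to consider preimages of open sets, hence of the countably many
rational boxes, which are finite intersections of conditions on coordinates. *)
Lemma measurable_mx_coords d (T : measurableType d) (f : T -> 'M[R]_(m, n)) :
  (forall i j, measurable_fun setT (fun t => f t i j)) -> measurable_fun setT f.
Proof.
move=> mf; apply: (@measurability _ _ _ _ _ _ (@open 'M[R]_(m, n))) => //.
move=> _ [B oB <-]; rewrite setTI (open_bigcup_boxes oB) preimage_bigcup.
rewrite bigcup_mkcond; apply: countable_bigcupT_measurable => // p.
case: ifPn => // _.
have -> : f @^-1` box p =
    \bigcap_(ij in [set: 'I_m * 'I_n])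
      [set t | `|f t ij.1 ij.2 - ratr (p.1 ij.1 ij.2)| < p.2.+1%:R^-1].
  apply/seteqP; split=> t /= ft; first by move=> [i j] _; exact: ft.
  by move=> i j; exact: (ft (i, j)).
apply: fin_bigcap_measurable => [|[i j] _ /=]; first exact: finite_finset.
rewrite -[X in measurable X]setTI.
apply: measurable_fun_ltr => //; apply: measurableT_comp => //.
exact: measurable_funB.
Qed.

End matrix_measurability.

(** * Sigma-finiteness of measures with a first moment *)

Section orthant_measures.
Context {R : realType} {d : nat}.
Implicit Types (s x y : 'cV[R]_d).

Lemma measurable_orthant : measurable (@orthant R d).
Proof.
have -> : @orthant R d =
    \bigcap_(i in [set: 'I_d]) [set s : 'cV[R]_d | 0 <= s i 0].
  by apply/seteqP; split=> s os i => [_|]; exact: os.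
apply: fin_bigcap_measurable => [|i _]; first exact: finite_finset.
rewrite -[X in measurable X]setTI; apply: measurable_fun_ler => //.
exact: measurable_coord.
Qed.

Lemma measurable_dot d1 (T : measurableType d1) (f g : T -> 'cV[R]_d) :
  (forall i, measurable_fun setT (fun t => f t i 0)) ->
  (forall i, measurable_fun setT (fun t => g t i 0)) ->
  measurable_fun setT (fun t => dot (f t) (g t)).
Proof. by move=> mf mg; apply: measurable_sum => i; exact: measurable_funM. Qed.

Lemma measurable_enorm : measurable_fun setT (@enorm R d).
Proof.
have -> : @enorm R d = Num.sqrt \o (fun u => dot u u) by [].
apply: measurableT_comp.
  by apply: continuous_measurable_fun; exact: sqrt_continuous.
by apply: measurable_dot => i; exact: measurable_coord.
Qed.

Lemma coord_le_enorm s i : `|s i 0| <= enorm s.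
Proof.
rewrite -sqrtr_sqr ler_wsqrtr// /dot (bigD1 i)//= expr2 lerDl.
by apply: sumr_ge0 => j _; rewrite -expr2 sqr_ge0.
Qed.

Lemma enorm_eq0 s : enorm s = 0 -> s = 0.
Proof.
move=> s0; apply/matrixP => i j; rewrite (ord1 j) mxE.
by apply/eqP; rewrite -normr_eq0 eq_le normr_ge0 -s0 coord_le_enorm.
Qed.

(** The space is covered by the origin, the complement of the orthant, and the
parts of the orthant where the norm is at least 1/(n + 1), which have finite
measure by Markov's inequality. *)
Lemma sigma_finite_first_moment (nu : {measure set 'cV[R]_d -> \bar R}) :
  (nu [set 0%R : 'cV[R]_d] < +oo)%E -> nu (~` orthant) = 0%E ->
  (\int[nu]_(s in orthant) (enorm s)%:E < +oo)%E ->
  sigma_finite setT nu.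
Proof.
move=> nu0 nuC noo.
pose F n : set 'cV[R]_d := [set (0 : 'cV[R]_d)] `|` ~` orthant `|`
  (orthant `&` [set s : 'cV[R]_d | n.+1%:R^-1 <= enorm s]).
have m0 : measurable [set 0 : 'cV[R]_d].
  have -> : [set 0 : 'cV[R]_d] = enorm @^-1` [set 0].
    apply/seteqP; split=> s /= => [->|]; last exact: enorm_eq0.
    by rewrite /enorm /dot big1 ?sqrtr0// => i _; rewrite mxE mul0r.
  by rewrite -[X in measurable X]setTI; exact: measurable_enorm.
have mo := measurable_orthant; have mC := measurableC mo.
have mG n : measurable [set s : 'cV[R]_d | n.+1%:R^-1 <= enorm s].
  rewrite -[X in measurable X]setTI; apply: measurable_fun_ler => //.
  exact: measurable_enorm.
have mOG n := measurableI _ _ mo (mG n).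
exists F => [|n].
  apply/esym/seteqP; split=> // s _.
  have [s0|ns0] := eqVneq (enorm s) 0.
    by exists 0%N => //; left; left; exact: enorm_eq0.
  have [os|nos] := pselect (orthant s); last by exists 0%N => //; left; right.
  have s0 : 0 < enorm s by rewrite lt_neqAle eq_sym ns0 sqrtr_ge0.
  have [N _ Ns] := near_infty_natSinv_lt (PosNum s0).
  by exists N => //; right; split=> //=; apply/ltW; apply: (Ns N) => /=.
split; first by apply: measurableU => //; exact: measurableU.
rewrite /F.
apply: le_lt_trans (measureU2 _ _ _) _ => //; first exact: measurableU.
apply: lte_add_pinfty.
  apply: le_lt_trans (measureU2 _ _ _) _ => //.
  by rewrite [X in (_ + X)%E]nuC adde0.
have h : ((n.+1%:R^-1)%:E * nu (orthant `&` [set s | (n.+1%:R^-1 <= enorm s)%R])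
    <= \int[nu]_(s in orthant) (enorm s)%:E)%E.
  rewrite -integral_cst//.
  apply: (@le_trans _ _ (\int[nu]_(s in orthant `&`
      [set s | (n.+1%:R^-1 <= enorm s)%R]) (enorm s)%:E)%E).
    apply: ge0_le_integral => //.
    - by move=> s _; rewrite lee_fin.
    - by apply/measurable_EFinP/measurable_funTS; exact: measurable_enorm.
    - by move=> s [_ /=]; rewrite lee_fin.
  apply: ge0_subset_integral => //.
  - by apply/measurable_EFinP/measurable_funTS; exact: measurable_enorm.
  - by move=> s _; rewrite lee_fin sqrtr_ge0.
move: (le_lt_trans h noo); rewrite -lte_pdivlMl// ?invr_gt0//.
by rewrite mulry gtr0_sg ?mul1e ?invr_gt0.
Qed.

End orthant_measures.

(** Turns the property into the structure over which Fubini's theorem is stated,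
without changing the measure. *)
Lemma sigma_finite_measureP d (T : measurableType d) (R : realType)
    (mu : {measure set T -> \bar R}) : sigma_finite setT mu ->
  exists m : {sigma_finite_measure set T -> \bar R}, mu = m.
Proof.
case: mu => mu cmu sf.
pose mu' : {measure set T -> \bar R} := Measure.Pack cmu.
pose m : {sigma_finite_measure set T -> \bar R} :=
  HB.pack (mu : set T -> \bar R) mu' (@Measure_isSigmaFinite.Build _ _ _ mu' sf).
by exists m.
Qed.

(** * Expectations of functions of exponential variables *)

Section exponential_law.
Context {R : realType} {dO : measure_display} {Omega : measurableType dO}.
Variables (P : probability Omega R).

Lemma meanE (f : Omega -> R) : mean P f = \int[P]_w f w.
Proof. by rewrite /mean unlock. Qed.

(** The reals carry two Borel structures, one generated by intervals (on which the
exponential law lives) and the default one.  They have the same measurable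
sets, and the identity passes from one to the other. *)
Lemma measurable_typeR : measurable_fun setT (fun u : measurableTypeR R => u : R).
Proof. by move=> mT Y mY; rewrite setTI. Qed.

Lemma measurable_RV_typeR (E : {RV P >-> R}) :
  measurable_fun setT (E : Omega -> measurableTypeR R).
Proof. by move=> mT Y mY; exact: (measurable_funPT E mT Y mY). Qed.

Lemma mean_exp1 (E : {RV P >-> R}) (g : measurableTypeR R -> R) : exp1_law E ->
  measurable_fun setT g -> mean P (fun w => g (E w)) = \int[exp1]_e g e.
Proof.
move=> hE mg; rewrite meanE.
apply: (@Rintegral_law _ _ _ (measurableTypeR R) _ P exp1 E) => //.
exact: measurable_RV_typeR.
Qed.

(** A measure on a product is determined by its values on rectangles, where
independence, applied with a sure event for X, makes the joint law of (E', E) a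
product. *)
Lemma mean_exp1_pair d (X : {RV P >-> 'cV[R]_d}) (E E' : {RV P >-> R})
    (g : measurableTypeR R * measurableTypeR R -> R) :
  exp1_law E -> exp1_law E' -> independent3 X E E' ->
  measurable_fun setT g ->
  mean P (fun w => g (E' w, E w)) = \int[(@exp1 R \x @exp1 R)%E]_z g z.
Proof.
move=> hE hE' hind mg; rewrite meanE.
pose phi w : measurableTypeR R * measurableTypeR R := (E' w, E w).
have mphi : measurable_fun setT phi.
  by apply: measurable_fun_pair; exact: measurable_RV_typeR.
pose pf : {measure set (measurableTypeR R * measurableTypeR R) -> \bar R} :=
  pushforward P phi.
pose law := pf mphi.
apply: (@Rintegral_law _ _ _ _ _ P _ phi) => // A mA.
have lawX B C : measurable B -> measurable C ->
    law (B `*` C) = (exp1 B * exp1 C)%E.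
  move=> mB mC; rewrite /law /pf /pushforward /=.
  transitivity (P (X @^-1` setT `&` E @^-1` C `&` E' @^-1` B)).
    by congr (P _); rewrite preimage_setT setTI setIC; apply/seteqP; split.
  rewrite hind//= preimage_setT probability_setT mul1e muleC.
  by congr (_ * _)%E; [exact: hE'|exact: hE].
exact: (esym (product_measure_unique lawX mA)).
Qed.
End exponential_law.

(** * The Stein kernel of a scalar kernel *)

Lemma dot_col_scalar (R : realType) d (s : 'cV[R]_d) (c : R) (j : 'I_d) :
  dot s (col j c%:M) = s j 0 * c.
Proof.
rewrite /dot (bigD1 j)//= !mxE eqxx mulr1n big1 ?addr0// => i ij.
by rewrite !mxE (negbTE ij) mulr0n mulr0.
Qed.

Section stein_kernel.
Context {R : realType} {d : nat}.
Variables (nu : {sigma_finite_measure set 'cV[R]_d -> \bar R}).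
Variables (k : 'cV[R]_d -> 'cV[R]_d -> R).
Hypothesis mk : measurable_fun [set: 'cV[R]_d * 'cV[R]_d] (fun p => k p.1 p.2).
Notation U := (measurableTypeR R).
Notation D := (@orthant R d).
Implicit Types (s x y : 'cV[R]_d).

Let mD : measurable D := measurable_orthant.

Lemma measurable_translate d1 (T : measurableType d1) (x : T -> 'cV[R]_d)
    (e : T -> U) (s : T -> 'cV[R]_d) :
  measurable_fun setT x -> measurable_fun setT e -> measurable_fun setT s ->
  measurable_fun setT (fun t => x t + (e t : R) *: s t).
Proof.
move=> mx me ms; apply: measurable_mx_coords => i j.
rewrite (_ : (fun t => _) = (fun t => x t i j + (e t : R) * s t i j)); last first.
  by apply/funext => t; rewrite !mxE.
apply: measurable_funD; first exact: (measurableT_comp (measurable_coord i j) mx).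
apply: measurable_funM.
  exact: (measurableT_comp (@measurable_typeR R) me).
exact: (measurableT_comp (measurable_coord i j) ms).
Qed.

Lemma measurable_kernel d1 (T : measurableType d1) (f g : T -> 'cV[R]_d) :
  measurable_fun setT f -> measurable_fun setT g ->
  measurable_fun setT (fun t => k (f t) (g t)).
Proof.
move=> mf mg; exact: (measurableT_comp mk (measurable_fun_pair mf mg)).
Qed.

(** E[k(x, y + s E)]. *)
Definition smoothed x y s : R := \int[exp1]_e k x (y + (e : R) *: s).

(** The integral part of the Stein operator acting on y: the vector of the
integrals of s_j E[k(x, y + s E)] against nu(ds). *)
Definition thorin_average x y : 'cV[R]_d :=
  \col_j \int[nu]_(s in D) (s j 0 * smoothed x y s).

(** The j-th column of k I_d is k e_j, so the inner operator yields the vector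
k(x, y) y minus its integral part; the outer operator is applied to that vector
as it stands, before any exchange of integrals. *)
Lemma stein_kernel_scalar x y :
  stein_kernel nu (fun u v => (k u v)%:M) x y =
  dot x y * k x y - dot x (thorin_average x y) -
  \int[nu]_(s in D) \int[exp1]_e
    (dot s y * k (x + (e : R) *: s) y - dot s (thorin_average (x + (e : R) *: s) y)).
Proof.
have stein_col z j : stein_op nu (fun y => col j (k z y)%:M) y =
    y j 0 * k z y - thorin_average z y j 0.
  rewrite /stein_op dot_col_scalar mxE; congr (_ - _).
  apply: eq_Rintegral => s _; rewrite meanE -measurable_RintegralZl//.
    by apply: eq_Rintegral => e _; rewrite dot_col_scalar.
  by apply: measurable_kernel => //; exact: measurable_translate.
have dotB s z : dot s (\col_j stein_op nu (fun y => col j (k z y)%:M) y) =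
    dot s y * k z y - dot s (thorin_average z y).
  rewrite /dot mulr_suml -sumrB; apply: eq_bigr => j _.
  by rewrite mxE stein_col mulrBr mulrA.
rewrite /stein_kernel /stein_op dotB; congr (_ - _).
by apply: eq_Rintegral => s _; rewrite meanE; apply: eq_Rintegral => e _; rewrite dotB.
Qed.

Lemma measurable_smoothed d1 (T : measurableType d1) (f g h : T -> 'cV[R]_d) :
  measurable_fun setT f -> measurable_fun setT g -> measurable_fun setT h ->
  measurable_fun setT (fun t => smoothed (f t) (g t) (h t)).
Proof.
move=> mf mg mh.
apply: (@measurable_Rintegral _ _ _ _ _ (@exp1 R) setT
  (fun z : T * U => k (f z.1) (g z.1 + (z.2 : R) *: h z.1))) => //.
apply: measurable_kernel; first exact: measurableT_comp.
apply: measurable_translate => //; exact: measurableT_comp.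
Qed.

Lemma measurable_thorin_average d1 (T : measurableType d1) (f : T -> 'cV[R]_d) y j :
  measurable_fun setT f -> measurable_fun setT (fun t => thorin_average (f t) y j 0).
Proof.
move=> mf; rewrite (_ : (fun t => _) = (fun t =>
    \int[nu]_(s in D) (s j 0 * smoothed (f t) y s))); last first.
  by apply/funext => t; rewrite mxE.
apply: (@measurable_Rintegral _ _ _ _ _ nu D
  (fun z : T * 'cV[R]_d => z.2 j 0 * smoothed (f z.1) y z.2)) => //.
apply: measurable_funM.
  exact: (measurableT_comp (measurable_coord j 0) measurable_snd).
by apply: measurable_smoothed => //; exact: measurableT_comp.
Qed.

(** E[k(x + s' E', y + s E)], for independent E' and E. *)
Definition smoothed2 x y s' s : R :=
  \int[(@exp1 R \x @exp1 R)%E]_z k (x + (z.1 : R) *: s') (y + (z.2 : R) *: s).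

Lemma measurable_smoothed2 d1 (T : measurableType d1) x y (g h : T -> 'cV[R]_d) :
  measurable_fun setT g -> measurable_fun setT h ->
  measurable_fun setT (fun t => smoothed2 x y (g t) (h t)).
Proof.
move=> mg mh.
apply: (@measurable_Rintegral _ _ _ (U * U)%type _
  [the probability (U * U)%type R of (@exp1 R \x @exp1 R)%E] setT
  (fun z : T * (U * U) => k (x + (z.2.1 : R) *: g z.1) (y + (z.2.2 : R) *: h z.1))) => //.
apply: measurable_kernel; apply: measurable_translate => //;
  by apply: measurableT_comp => //; exact: measurableT_comp.
Qed.

Section expansion.
Variables x y : 'cV[R]_d.

Let C := \sum_(i < d) `|y i 0|.

Lemma dot_le_enorm s : `|dot s y| <= C * enorm s.
Proof.
rewrite mulr_suml; apply: le_trans (ler_norm_sum _ _ _) _.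
by apply: ler_sum => i _; rewrite normrM mulrC ler_wpM2l// coord_le_enorm.
Qed.

Let enorm_ge0 s : 0 <= enorm s. Proof. exact: sqrtr_ge0. Qed.

(** Linearity in s, coordinate by coordinate.  Each coordinate is integrable
because it is bounded by the Euclidean norm of s. *)
Lemma dot_thorin_average :
  (\int[nu]_(s in D) \int[exp1]_e
         (enorm s * `|k x (y + (e : R) *: s)|)%:E < +oo)%E ->
  dot x (thorin_average x y) = \int[nu]_(s in D) (dot x s * smoothed x y s).
Proof.
move=> koo.
have icoord i : nu.-integrable D (EFin \o (fun s => s i 0 * smoothed x y s)).
  apply: (integrable_weighted (b := @enorm R d) (c := 1) (m := @exp1 R)
    (F := fun z : 'cV[R]_d * U => k x (y + (z.2 : R) *: z.1)) _ _ _ _ _ _ _ koo).1 => //.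
  - exact: measurable_enorm.
  - exact: measurable_coord.
  - by apply: measurable_kernel => //; exact: measurable_translate.
  - by move=> s _; rewrite mul1r coord_le_enorm.
have -> : dot x (thorin_average x y) =
    \sum_(i < d) \int[nu]_(s in D) (x i 0 * (s i 0 * smoothed x y s)).
  by apply: eq_bigr => i _; rewrite mxE RintegralZl.
rewrite -Rintegral_sum//.
  by apply: eq_Rintegral => s _; rewrite mulr_suml; apply: eq_bigr => i _; rewrite mulrA.
move=> i; have := integrableZl mD (x i 0) (icoord i).
by apply: eq_integrable => // s _ /=; rewrite EFinM.
Qed.

(** The first part makes the integral of <s', y> E[k(x + s' E', y)] converge; the
second one allows the expectation to be split, for almost every s', into this
term and the double term. *)
Lemma integrable_dot_smoothed :
  (\int[nu]_(s' in D) \int[exp1]_e'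
         (enorm s' * `|k (x + (e' : R) *: s') y|)%:E < +oo)%E ->
  nu.-integrable D (EFin \o (fun s => dot s y * \int[exp1]_e k (x + (e : R) *: s) y)) /\
  {ae nu, forall s, D s ->
    (@exp1 R).-integrable setT (EFin \o (fun e => dot s y * k (x + (e : R) *: s) y))}.
Proof.
move=> koo.
apply: (integrable_weighted (b := @enorm R d) (c := C) (m := @exp1 R)
    (F := fun z : 'cV[R]_d * U => k (x + (z.2 : R) *: z.1) y) _ _ _ _ _ _ _ koo) => //.
- exact: measurable_enorm.
- by apply: measurable_dot => i //; exact: measurable_coord.
- by apply: measurable_kernel => //; exact: measurable_translate.
- by apply: sumr_ge0.
- by move=> s _; exact: dot_le_enorm.
Qed.

Definition dotk (z : 'cV[R]_d * 'cV[R]_d * (U * U)) : R :=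
  dot z.1.1 z.1.2 * k (x + (z.2.1 : R) *: z.1.1) (y + (z.2.2 : R) *: z.1.2).

Lemma measurable_dotk d1 (T : measurableType d1) (f g : T -> 'cV[R]_d)
    (u v : T -> U) :
  measurable_fun setT f -> measurable_fun setT g ->
  measurable_fun setT u -> measurable_fun setT v ->
  measurable_fun setT (fun t => dotk (f t, g t, (u t, v t))).
Proof.
move=> mf mg mu mv; apply: measurable_funM => /=.
  by apply: measurable_dot => i; exact: (measurableT_comp (measurable_coord i 0)).
by apply: measurable_kernel; exact: measurable_translate.
Qed.

(** The mass at (s', s) whose double integral is assumed to be finite.  The
absolute value covers the scalar product too, so that the integrand is
nonnegative outside the orthant as well, where Tonelli's theorem also needs it
to obtain the measurability of the mass. *)
Definition absmass (s' s : 'cV[R]_d) : \bar R :=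
  (\int[@exp1 R]_u \int[@exp1 R]_v `|dotk (s', s, (u, v))|%:E)%E.

Lemma measurable_absmass : measurable_fun setT
  (fun z : 'cV[R]_d * 'cV[R]_d => absmass z.1 z.2).
Proof.
apply: (@measurable_ge0_integral _ _ _ _ _ (@exp1 R) setT
  (fun z : ('cV[R]_d * 'cV[R]_d) * U =>
    \int[@exp1 R]_v `|dotk (z.1.1, z.1.2, (z.2, v))|%:E)%E) => //; last first.
  by move=> *; exact: integral_ge0.
apply: (@measurable_ge0_integral _ _ _ _ _ (@exp1 R) setT
  (fun z : (('cV[R]_d * 'cV[R]_d) * U) * U =>
    `|dotk (z.1.1.1, z.1.1.2, (z.1.2, z.2))|%:E)%E) => //.
apply/measurable_EFinP; apply: measurableT_comp => //.
apply: measurable_dotk => //; do ?[exact: measurableT_comp];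
 by apply: measurableT_comp => //; exact: measurableT_comp.
Qed.

Let absmass_ge0 s' s : (0 <= absmass s' s)%E.
Proof. by apply: integral_ge0 => u _; exact: integral_ge0. Qed.

Hypothesis kkoo : (\int[nu]_(s' in D) \int[nu]_(s in D) absmass s' s < +oo)%E.

Let measurable_mass :
  measurable_fun setT (fun s' => \int[nu]_(s in D) absmass s' s)%E.
Proof.
exact: (@measurable_ge0_integral _ _ _ _ _ nu D
  (fun z : 'cV[R]_d * 'cV[R]_d => absmass z.1 z.2) mD measurable_absmass).
Qed.

Lemma integrable_double :
  nu.-integrable D
    (EFin \o (fun s' => \int[nu]_(s in D) (dot s' s * smoothed2 x y s' s))).
Proof.
have mdot : measurable_fun setT
    (fun z : 'cV[R]_d * 'cV[R]_d => dot z.1 z.2 * smoothed2 x y z.1 z.2).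
  apply: measurable_funM; last exact: measurable_smoothed2.
  by apply: measurable_dot => i; exact: (measurableT_comp (measurable_coord i 0)).
have mB := @measurable_Rintegral _ _ _ _ _ nu D _ mD mdot.
apply: integrable_lty => //; first exact: measurable_funTS.
apply: le_lt_trans kkoo; apply: ge0_le_integral => //.
- apply/measurable_EFinP/measurable_funTS; exact: measurableT_comp.
- exact: measurable_funTS.
move=> s' _.
apply: le_trans (le_abs_Rintegral _ _ _) _ => //.
  by apply: measurable_funTS; exact: measurable_fun_pair2 mdot.
apply: ge0_le_integral => //.
- apply/measurable_EFinP/measurable_funTS/measurableT_comp => //.
  exact: measurable_fun_pair2 mdot.
- by apply: measurable_funTS; exact: measurable_fun_pair2 measurable_absmass.
move=> s _; have mF : measurable_fun setT (fun z : U * U => dotk (s', s, z)).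
  rewrite (_ : (fun z => _) = (fun z : U * U => dotk (s', s, (z.1, z.2)))).
    exact: measurable_dotk.
  by apply/funext => -[].
rewrite /absmass -(@fubini_tonelli1 _ _ _ _ _ (@exp1 R) (@exp1 R)
  (fun z : U * U => `|dotk (s', s, z)|%:E))//; last first.
  by apply/measurable_EFinP; exact: measurableT_comp.
rewrite -measurable_RintegralZl//; last first.
  by apply: measurable_kernel; exact: measurable_translate.
exact: le_abs_Rintegral.
Qed.

(** The exchange of E' and s in the double term, at fixed s'.  It is performed for
each coordinate i with the weight s'_i s_i, which on the orthant lies between 0
and <s', s>: the s' at which the total mass is finite satisfy the hypothesis of
[Rintegral_exchange_product] for all i at once.  Keeping s'_i inside the weight
avoids a separate treatment of the s' with vanishing coordinates, for which
nothing is known about s_i k alone. *)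
Lemma ae_mean_thorin_average : {ae nu, forall s', D s' ->
  (@exp1 R).-integrable setT
    (EFin \o (fun u => dot s' (thorin_average (x + (u : R) *: s') y))) /\
  \int[exp1]_u dot s' (thorin_average (x + (u : R) *: s') y) =
  \int[nu]_(s in D) (dot s' s * smoothed2 x y s' s)}.
Proof.
have mass_ge0 s' : D s' -> (0 <= \int[nu]_(s in D) absmass s' s)%E.
  by move=> _; exact: integral_ge0.
have := ae_lty mD (measurable_funTS measurable_mass) mass_ge0 kkoo.
apply: filterS => s' s'oo Ds'.
pose F (z : 'cV[R]_d * (U * U)) := k (x + (z.2.1 : R) *: s') (y + (z.2.2 : R) *: z.1).
have mF : measurable_fun setT F.
  by apply: measurable_kernel; apply: measurable_translate => //;
    exact: measurableT_comp.
have mw i : measurable_fun setT (fun s : 'cV[R]_d => s' i 0 * s i 0).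
  by apply: measurable_funM => //; exact: measurable_coord.
have woo i : (\int[nu]_(s in D) \int[@exp1 R]_u \int[@exp1 R]_v
    `|s' i 0 * s i 0 * F (s, (u, v))|%:E < +oo)%E.
  apply: le_lt_trans (s'oo Ds').
  have mi : measurable_fun setT
      (fun z : ('cV[R]_d * U) * U => (s' i 0 * z.1.1 i 0 * F (z.1.1, (z.1.2, z.2)))).
    apply: measurable_funM.
      apply: measurable_funM => //.
      by apply: (measurableT_comp (measurable_coord i 0)); exact: measurableT_comp.
    apply: (measurableT_comp mF); apply: measurable_fun_pair.
      exact: measurableT_comp.
    by apply: measurable_fun_pair => //; exact: measurableT_comp.
  have mia : measurable_fun setT (fun z : ('cV[R]_d * U) * U =>
      `|s' i 0 * z.1.1 i 0 * F (z.1.1, (z.1.2, z.2))|%:E).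
    by apply/measurable_EFinP; exact: measurableT_comp.
  have mi1 : measurable_fun setT (fun z : 'cV[R]_d * U =>
      \int[@exp1 R]_v `|s' i 0 * z.1 i 0 * F (z.1, (z.2, v))|%:E)%E.
    apply: (@measurable_ge0_integral _ _ _ _ _ (@exp1 R) setT
      (fun z : ('cV[R]_d * U) * U =>
        `|s' i 0 * z.1.1 i 0 * F (z.1.1, (z.1.2, z.2))|%:E)) => //.
  have md : measurable_fun setT (fun z : ('cV[R]_d * U) * U =>
      dotk (s', z.1.1, (z.1.2, z.2))).
    by apply: measurable_dotk => //; exact: measurableT_comp.
  have mda : measurable_fun setT (fun z : ('cV[R]_d * U) * U =>
      `|dotk (s', z.1.1, (z.1.2, z.2))|%:E).
    by apply/measurable_EFinP; exact: measurableT_comp.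
  have md1 : measurable_fun setT (fun z : 'cV[R]_d * U =>
      \int[@exp1 R]_v `|dotk (s', z.1, (z.2, v))|%:E)%E.
    apply: (@measurable_ge0_integral _ _ _ _ _ (@exp1 R) setT
      (fun z : ('cV[R]_d * U) * U =>
        `|dotk (s', z.1.1, (z.1.2, z.2))|%:E)) => //.
  apply: (ge0_le_integral _ mD).
  - by move=> s _; apply: integral_ge0 => u _; exact: integral_ge0.
  - apply: measurable_funTS.
    apply: (@measurable_ge0_integral _ _ _ _ _ (@exp1 R) setT (fun z : 'cV[R]_d * U =>
      \int[@exp1 R]_v `|s' i 0 * z.1 i 0 * F (z.1, (z.2, v))|%:E)%E) => //.
    by move=> *; exact: integral_ge0.
  - by apply: measurable_funTS; exact: measurable_fun_pair2 measurable_absmass.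
  move=> s Ds; apply: ge0_le_integral => //.
  - by move=> u _; exact: integral_ge0.
  - exact: (measurable_fun_pair2 s mi1).
  - exact: (measurable_fun_pair2 s md1).
  move=> u _; apply: ge0_le_integral => //.
  - exact: (measurable_fun_pair2 (s, u) mia).
  - exact: (measurable_fun_pair2 (s, u) mda).
  move=> v _; rewrite lee_fin !normrM ler_wpM2r// -normrM.
  rewrite ger0_norm ?mulr_ge0// (le_trans _ (ler_norm _))//.
  rewrite /dot (bigD1 i)//= lerDl; apply: sumr_ge0 => j _.
  by rewrite mulr_ge0.
have core i := Rintegral_exchange_product mD (mw i) mF (woo i).
have thorin_averageE u : dot s' (thorin_average (x + (u : R) *: s') y) =
    \sum_(i < d) \int[nu]_(s in D) (s' i 0 * s i 0 * \int[@exp1 R]_v F (s, (u, v))).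
  apply: eq_bigr => i _; rewrite mxE -measurable_RintegralZl//.
    by apply: eq_Rintegral => s _; rewrite mulrA.
  apply: measurable_funTS; apply: measurable_funM; first exact: measurable_coord.
  exact: measurable_smoothed.
have iu i : (@exp1 R).-integrable setT (EFin \o (fun u =>
    \int[nu]_(s in D) (s' i 0 * s i 0 * \int[@exp1 R]_v F (s, (u, v))))).
  by have [] := core i.
split.
  have := integrable_sum (P := xpredT) measurableT (index_enum 'I_d) (fun i _ => iu i).
  by apply: eq_integrable => // u _ /=; rewrite thorin_averageE sumEFin.
under eq_Rintegral do rewrite thorin_averageE.
rewrite Rintegral_sum//.
under eq_bigr => i _ do have [_ _ ->] := core i.
rewrite -Rintegral_sum// => [|i]; last by have [] := core i.
by apply: eq_Rintegral => s _; rewrite mulr_suml.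
Qed.

Hypothesis ky : (\int[nu]_(s in D) \int[exp1]_e
  (enorm s * `|k x (y + (e : R) *: s)|)%:E < +oo)%E.
Hypothesis kx : (\int[nu]_(s' in D) \int[exp1]_e'
  (enorm s' * `|k (x + (e' : R) *: s') y|)%:E < +oo)%E.

(** The integrands in s' agree for almost every s' only, namely where
[integrable_dot_smoothed] and [ae_mean_thorin_average] apply. *)
Lemma stein_kernel_expansion :
  stein_kernel nu (fun u v => (k u v)%:M) x y =
  dot x y * k x y - \int[nu]_(s in D) (dot x s * smoothed x y s)
  - \int[nu]_(s' in D) (dot s' y * \int[exp1]_e k (x + (e : R) *: s') y)
  + \int[nu]_(s' in D) \int[nu]_(s in D) (dot s' s * smoothed2 x y s' s).
Proof.
rewrite stein_kernel_scalar dot_thorin_average// -[RHS]addrA; congr (_ + _).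
have [ix aex] := integrable_dot_smoothed kx.
rewrite addrC -opprB; congr (- _).
rewrite -RintegralB//; last exact: integrable_double.
apply: ae_eq_Rintegral => //.
- apply: measurable_funTS.
  apply: (@measurable_Rintegral _ _ _ _ _ (@exp1 R) setT (fun z : 'cV[R]_d * U =>
    dot z.1 y * k (x + (z.2 : R) *: z.1) y
    - dot z.1 (thorin_average (x + (z.2 : R) *: z.1) y))) => //.
  have mt : measurable_fun setT (fun z : 'cV[R]_d * U => x + (z.2 : R) *: z.1).
    exact: measurable_translate.
  apply: measurable_funB.
    apply: measurable_funM; last exact: measurable_kernel.
    by apply: measurable_dot => i //; exact: (measurableT_comp (measurable_coord i 0)).
  apply: measurable_dot => i; last exact: measurable_thorin_average.
  exact: (measurableT_comp (measurable_coord i 0)).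
- apply: measurable_funB.
    by apply/measurable_EFinP; exact: measurable_int ix.
  by apply/measurable_EFinP; exact: measurable_int integrable_double.
apply: filterS2 aex ae_mean_thorin_average => s' iks ids Ds'.
have {}iks := iks Ds'; have {ids}[ids ds] := ids Ds'.
rewrite RintegralB// ds measurable_RintegralZl//.
by apply: measurable_kernel => //; exact: measurable_translate.
Qed.

End expansion.
End stein_kernel.

Theorem theorem5p1 (R : realType) (d : nat) (hd : (1 <= d)%N)
  (dO : measure_display) (Omega : measurableType dO) (P : probability Omega R)
  (nu : {measure set 'cV[R]_d -> \bar R})
  (hnu : thorin_measure nu)
  (hnu1 : (\int[nu]_(s in orthant) (enorm s)%:E < +oo)%E)
  (X : {RV P >-> 'cV[R]_d}) (hX : thorin_law nu X)
  (k : 'cV[R]_d -> 'cV[R]_d -> R) (hk : reproducing_kernel k)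
  (hkm : measurable_fun [set: 'cV[R]_d * 'cV[R]_d] (fun p => k p.1 p.2))
  (E E' : {RV P >-> R}) (hE : exp1_law E) (hE' : exp1_law E')
  (hind : independent3 X E E') :
  forall x y : 'cV[R]_d, stein_integrable nu k x y ->
    (stein_kernel nu (fun u v => (k u v)%:M) x y =
       dot x y * k x y
       - (\int[nu]_(s in orthant)
            (dot x s * mean P (fun w => k x (y + E w *: s))))
       - (\int[nu]_(s' in orthant)
            (dot s' y * mean P (fun w => k (x + E' w *: s') y)))
       + (\int[nu]_(s' in orthant) \int[nu]_(s in orthant)
            (dot s' s * mean P (fun w => k (x + E' w *: s') (y + E w *: s)))))
    /\
    (forall (n : nat) (alpha : 'I_n -> R) (a : 'I_n -> 'cV[R]_d),
       (forall j, 0 < alpha j) -> (forall j, orthant (a j)) ->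
       (forall A : set 'cV[R]_d, measurable A ->
          nu A = (\sum_(j < n) (alpha j)%:E * \d_(a j) A)%E) ->
       stein_kernel nu (fun u v => (k u v)%:M) x y =
         dot x y * k x y
         - \sum_(j < n)
             alpha j * dot x (a j) * mean P (fun w => k x (y + E w *: a j))
         - \sum_(j < n)
             alpha j * dot (a j) y * mean P (fun w => k (x + E' w *: a j) y)
         + \sum_(j < n) \sum_(j' < n)
             alpha j * alpha j' * dot (a j') (a j) *
             mean P (fun w => k (x + E' w *: a j') (y + E w *: a j))).
Proof.
case: hnu => -[nu_compact _] nuC _ _.
have /sigma_finite_measureP [m nuE] : sigma_finite setT nu.
  by apply: sigma_finite_first_moment => //; exact/nu_compact/compact_set1.
subst nu => x y [ky kx kxy].
have mD := @measurable_orthant R d.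
have smoothedE (s : 'cV[R]_d) : mean P (fun w => k x (y + E w *: s)) = smoothed k x y s.
  apply: (mean_exp1 (g := fun e => k x (y + (e : R) *: s))) => //.
  by apply: measurable_kernel => //; exact: measurable_translate.
have smoothedE' (s : 'cV[R]_d) : mean P (fun w => k (x + E' w *: s) y) =
    \int[exp1]_e k (x + (e : R) *: s) y.
  apply: (mean_exp1 (g := fun e => k (x + (e : R) *: s) y)) => //.
  by apply: measurable_kernel => //; exact: measurable_translate.
have smoothed2E (s' s : 'cV[R]_d) : mean P (fun w => k (x + E' w *: s') (y + E w *: s)) =
    smoothed2 k x y s' s.
  apply: (mean_exp1_pair hE hE' hind
    (g := fun z : measurableTypeR R * measurableTypeR R =>
    k (x + (z.1 : R) *: s') (y + (z.2 : R) *: s))).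
  by apply: measurable_kernel => //; exact: measurable_translate.
have kxy' : (\int[m]_(s' in orthant) \int[m]_(s in orthant) absmass k x y s' s < +oo)%E.
  apply: le_lt_trans kxy; rewrite le_eqVlt; apply/orP; left; apply/eqP.
  apply: eq_integral => s' /set_mem Ds'; apply: eq_integral => s /set_mem Ds.
  apply: eq_integral => u _; apply: eq_integral => v _.
  by rewrite normrM ger0_norm// sumr_ge0// => i _; rewrite mulr_ge0.
have expansion := stein_kernel_expansion hkm kxy' ky kx.
split=> [|n alpha a alpha_gt0 aD mE].
  rewrite expansion; congr (_ - _ - _ + _).
  - by apply: eq_Rintegral => s _; rewrite smoothedE.
  - by apply: eq_Rintegral => s _; rewrite smoothedE'.
  - apply: eq_Rintegral => s' _; apply: eq_Rintegral => s _.
    by rewrite smoothed2E.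
have atoms f (mf : measurable_fun setT f) :=
  Rintegral_atoms mD mf (fun j => ltW (alpha_gt0 j)) aD mE.
have mdot x' : measurable_fun setT (fun s : 'cV[R]_d => dot x' s).
  by apply: measurable_dot => i //; exact: measurable_coord.
have mdot2 : measurable_fun setT (fun z : 'cV[R]_d * 'cV[R]_d =>
    dot z.1 z.2 * smoothed2 k x y z.1 z.2).
  apply: measurable_funM; last exact: measurable_smoothed2.
  by apply: measurable_dot => i; exact: (measurableT_comp (measurable_coord i 0)).
rewrite expansion; congr (_ - _ - _ + _).
- rewrite atoms; first by apply: eq_bigr => j _; rewrite smoothedE mulrA.
  by apply: measurable_funM => //; exact: measurable_smoothed.
- rewrite atoms; first by apply: eq_bigr => j _; rewrite smoothedE' mulrA.
  apply: measurable_funM.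
    by apply: measurable_dot => i //; exact: measurable_coord.
  apply: (@measurable_Rintegral _ _ _ _ _ (@exp1 R) setT
    (fun z : 'cV[R]_d * measurableTypeR R => k (x + (z.2 : R) *: z.1) y)) => //.
  by apply: measurable_kernel => //; exact: measurable_translate.
- rewrite atoms; last first.
    exact: (@measurable_Rintegral _ _ _ _ _ m orthant _ mD mdot2).
  rewrite exchange_big; apply: eq_bigr => j' _ /=.
  rewrite atoms; last exact: measurable_fun_pair2 mdot2.
  rewrite mulr_sumr; apply: eq_bigr => j _; rewrite smoothed2E.
  by rewrite !mulrA (mulrC (alpha j)).
Qed.
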